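(* Let $\mathbb{F}$ be an algebraically closed field, let $n$ be a positive integer, and let $A=M_n(\mathbb{F})$. Let $\mathcal{M}$ be the family of admissible subsets of $A$, and let $\mathcal{M}_s$ (resp. $\mathcal{M}_n$) be the family of all $M\in\mathcal{M}$ with $M\subseteq A_s$ (resp. $M\subseteq A_n$). Then the maps $$\mathcal{M}\to\mathcal{M}_s\times\mathcal{M}_n,\qquad M\mapsto (M\cap A_s,\ M\cap A_n),$$ $$\mathcal{M}_s\times\mathcal{M}_n\to\mathcal{M},\qquad (M_s,M_n)\mapsto\{X\in A:\ X_s\in M_s,\ X_n\in M_n\}$$ are (well defined and) mutually inverse bijections.
   Context: A subset $M\subseteq A=M_n(\mathbb{F})$ is called admissible (i.e. $M\in\mathcal{M}$) if: (i) $0\in M$; (ii) $gMg^{-1}=M$ for every invertible $g\in A$; (iii) for all $X,Y\in M$ with $XY=YX$, the linear span $\langle X,Y\rangle$ is contained in $M$. $A_s\subseteq A$ denotes the set of all diagonalizable matrices and $A_n\subseteq A$ the set of all nilpotent matrices. For $X\in A$, $X_s$ and $X_n$ denote the semisimple and nilpotent parts of $X$ in its additive Jordan decomposition $X=X_s+X_n$ (with $X_s$ diagonalizable, $X_n$ nilpotent, $X_sX_n=X_nX_s$). *)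

(* Defs.v *)
From HB Require Import structures.
From mathcomp Require Import all_boot all_order all_algebra.
From mathcomp Require Import all_classical.

Set Implicit Arguments.
Unset Strict Implicit.
Unset Printing Implicit Defensive.

Import GRing.Theory.
Local Open Scope classical_set_scope.
Local Open Scope ring_scope.

Section Admissible.
Variables (F : fieldType) (n : nat).
Implicit Types (X Y S N g : 'M[F]_n) (M : set 'M[F]_n).

Definition nilpotent_mx X : Prop := exists k : nat, X ^+ k = 0.

Definition diagonalizable_set : set 'M[F]_n := [set X | diagonalizable X].
Definition nilpotent_set : set 'M[F]_n := [set X | nilpotent_mx X].

Definition admissible M : Prop :=
  [/\ M 0,
      forall g, g \in unitmx -> [set g *m X *m invmx g | X in M] = M
    & forall X Y, M X -> M Y -> X *m Y = Y *m X ->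
        [set Z | Z \in <<[:: X; Y]>>%VS] `<=` M].

Definition jordan_decomposition X S N : Prop :=
  [/\ X = S + N, diagonalizable S, nilpotent_mx N & S *m N = N *m S].

(* Over an algebraically closed field the decomposition exists and is unique,
   so the choice is forced and the default value (0, 0) is never returned. *)
Definition jordan_parts X : 'M[F]_n * 'M[F]_n :=
  xget (0, 0) [set p | jordan_decomposition X p.1 p.2].

Definition semisimple_part X : 'M[F]_n := (jordan_parts X).1.
Definition nilpotent_part X : 'M[F]_n := (jordan_parts X).2.

Definition admissible_family : set (set 'M[F]_n) := [set M | admissible M].
Definition admissible_ss_family : set (set 'M[F]_n) :=
  [set M | admissible M /\ M `<=` diagonalizable_set].
Definition admissible_nil_family : set (set 'M[F]_n) :=
  [set M | admissible M /\ M `<=` nilpotent_set].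

Definition split_admissible M : set 'M[F]_n * set 'M[F]_n :=
  (M `&` diagonalizable_set, M `&` nilpotent_set).

Definition join_admissible (p : set 'M[F]_n * set 'M[F]_n) : set 'M[F]_n :=
  [set X | p.1 (semisimple_part X) /\ p.2 (nilpotent_part X)].

End Admissible.

Arguments admissible_family F n : clear implicits.
Arguments admissible_ss_family F n : clear implicits.
Arguments admissible_nil_family F n : clear implicits.

(* Main.v *)
Require Import Defs.
From mathcomp Require Import all_boot all_order all_algebra.
From mathcomp Require Import all_classical.
From mathcomp Require Import ring zify.

(** Everything reduces to one fact: an admissible set [M] contains [X = S + N]
    (Jordan decomposition) if and only if it contains both [S] and [N]
    ([admissible_jordan_parts]).  Granted this, [M] is recovered from its
    diagonalizable and nilpotent members, which is one half of the bijection.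

    If [S] and [N] are in [M] then so is [X], because [S] and [N] commute.  For
    the converse, [X] is similar to [S + c *: N] for every nonzero scalar [c]
    ([rescale_nilpotent_part]): on a Jordan block, conjugation by the diagonal
    matrix of the powers of [c] multiplies the nilpotent part by [c].  So
    [S + c *: N] is in [M], it commutes with [X], and as soon as [c != 1] the
    span of these two matrices contains [N], hence [S].

    The rescaling does not need the full Jordan normal form as a matrix
    identity.  After diagonalizing [S], the ring of matrices is cut along
    idempotents commuting with [S] and [N]: a nonzero such idempotent always
    contains one Jordan block as a direct summand ([split_jordan_block]), and
    induction on the rank of the idempotent finishes ([corner_rescale]).

    The other half of the bijection is bookkeeping with the Jordan
    decomposition.  The semisimple part of [X] is a polynomial in [X]
    ([jordan_poly_exists]), so the parts are unique and commute with whatever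
    commutes with [X]; hence they are compatible with conjugation and with linear
    combinations of commuting matrices, and the set obtained from a pair of
    admissible sets is again admissible.  A diagonalizable matrix has nilpotent
    part 0 and a nilpotent one has semisimple part 0, so that set meets the
    diagonalizable and the nilpotent matrices in the original pair. *)

Set Implicit Arguments.
Unset Strict Implicit.
Unset Printing Implicit Defensive.

Import GRing.Theory.
Local Open Scope classical_set_scope.
Local Open Scope ring_scope.

(** * Diagonalizable and nilpotent matrices *)

Section DiagonalizableNilpotent.
Variables (F : fieldType) (n : nat).
Implicit Types (X Y g : 'M[F]_n) (a b : F).

Lemma diagonalizable_eigenbasis X :
  diagonalizable X <->
  exists P d, P \in unitmx /\ P *m X = diag_mx d *m P.
Proof.
split=> [[P Pu /similar_diagPex[d /(similarP Pu) PX]]|[P [d [Pu PX]]]].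
  by exists P, d.
by exists P => //; apply/similar_diagPex; exists d; apply/(similarP Pu).
Qed.

Lemma diagonalizable_conj g X :
  g \in unitmx -> diagonalizable X -> diagonalizable (g *m X *m invmx g).
Proof.
move=> gu /diagonalizable_eigenbasis[P [d [Pu PX]]].
apply/diagonalizable_eigenbasis; exists (P *m invmx g), d.
by rewrite unitmx_mul Pu unitmx_inv gu !mulmxA mulmxKV // PX.
Qed.

(** Commuting diagonalizable matrices are diagonal in a common basis. *)
Lemma diagonalizable_lincomb a b X Y : comm_mx X Y ->
  diagonalizable X -> diagonalizable Y -> diagonalizable (a *: X + b *: Y).
Proof.
move=> XY dX dY.
have [P Pu /and3P[]] : codiagonalizable [:: X; Y].
  apply/codiagonalizableP; split=> [A B|A]; rewrite !inE.
    by move=> /orP[]/eqP-> /orP[]/eqP-> //; apply: comm_mx_sym.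
  by case/orP=> /eqP->.
move=> /similar_diagPex[d /(similarP Pu) PX] /similar_diagPex[e /(similarP Pu) PY] _.
apply/diagonalizable_eigenbasis; exists P, (a *: d + b *: e); split=> //.
by rewrite mulmxDr -!scalemxAr PX PY linearD !linearZ /= mulmxDl !scalemxAl.
Qed.

Lemma nilpotent0 : nilpotent_mx (0 : 'M[F]_n).
Proof. by exists 1%N. Qed.

Lemma nilpotent_conj g X :
  g \in unitmx -> nilpotent_mx X -> nilpotent_mx (g *m X *m invmx g).
Proof.
move=> gu [k Xk]; exists k.
have -> : (g *m X *m invmx g) ^+ k = g *m X ^+ k *m invmx g.
  elim: k {Xk} => [|k IHk]; first by rewrite !expr0 mulmx1 mulmxV.
  by rewrite !exprS IHk -!mulmxE !mulmxA mulmxKV.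
by rewrite Xk mulmx0 mul0mx.
Qed.

Lemma nilpotentZ a X : nilpotent_mx X -> nilpotent_mx (a *: X).
Proof.
move=> [k Xk]; exists k.
have -> : (a *: X) ^+ k = (a ^+ k) *: X ^+ k.
  elim: k {Xk} => [|k IHk]; first by rewrite !expr0 scale1r.
  by rewrite !exprS IHk -!mulmxE -scalemxAl -scalemxAr scalerA.
by rewrite Xk scaler0.
Qed.

Lemma nilpotentD X Y :
  comm_mx X Y -> nilpotent_mx X -> nilpotent_mx Y -> nilpotent_mx (X + Y).
Proof.
move=> XY [j Xj] [k Yk]; exists (j + k)%N; rewrite exprDn_comm //.
apply: big1 => i _; have [ik|ki] := leqP i k.
  by rewrite -addnBA // exprD Xj !mul0r mul0rn.
by rewrite -(subnK (ltnW ki)) (exprD Y) Yk !mulr0 mul0rn.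
Qed.

Lemma nilpotent_lincomb a b X Y : comm_mx X Y ->
  nilpotent_mx X -> nilpotent_mx Y -> nilpotent_mx (a *: X + b *: Y).
Proof.
move=> XY nX nY; apply: nilpotentD; try exact: nilpotentZ.
by rewrite /comm_mx -!scalemxAl -!scalemxAr XY !scalerA mulrC.
Qed.

Lemma diagonalizable_nilpotent_eq0 X :
  diagonalizable X -> nilpotent_mx X -> X = 0.
Proof.
move=> /diagonalizable_eigenbasis[P [d [Pu PX]]] [k Xk].
have PXk j : P *m X ^+ j = diag_mx (map_mx (fun x => x ^+ j) d) *m P.
  elim: j => [|j IHj].
    rewrite expr0 mulmx1 (_ : map_mx _ _ = const_mx 1) ?diag_const_mx ?mul1mx //.
    by apply/rowP => i; rewrite !mxE expr0.
  rewrite exprSr -mulmxE mulmxA IHj -mulmxA PX mulmxA mulmx_diag.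
  by congr (diag_mx _ *m _); apply/rowP => i; rewrite !mxE exprSr.
have d0 : d = 0.
  apply/rowP => i; rewrite mxE; apply/eqP.
  have := PXk k; rewrite Xk mulmx0 => /(congr1 (mulmxr (invmx P))) /=.
  rewrite mul0mx mulmxK // => /matrixP/(_ i i)/eqP.
  by rewrite !mxE eqxx mulr1n eq_sym expf_eq0 => /andP[].
by rewrite -[X](mulKmx Pu) PX d0 linear0 mul0mx mulmx0.
Qed.

End DiagonalizableNilpotent.

(** * Existence and uniqueness of the Jordan decomposition *)

Lemma jordan_conj (F : fieldType) n (g X S N : 'M[F]_n) :
    g \in unitmx -> jordan_decomposition X S N ->
  jordan_decomposition (g *m X *m invmx g)
    (g *m S *m invmx g) (g *m N *m invmx g).
Proof.
move=> gu [-> dS nN SN]; split.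
- by rewrite mulmxDr mulmxDl.
- exact: diagonalizable_conj.
- exact: nilpotent_conj.
- by rewrite !mulmxA !mulmxKV // -!(mulmxA g) SN.
Qed.

(** An explicit Chinese remainder: the powers of distinct linear factors are
    pairwise coprime, so a polynomial may be prescribed modulo each of them.
    The residues are the nodes themselves because the polynomial is meant to
    act as the scalar [a] on the generalized eigenspace of eigenvalue [a]. *)
Lemma simultaneous_congruence (F : fieldType) (m : nat) (s : seq F) : uniq s ->
  exists p : {poly F}, {in s, forall a, ('X - a%:P) ^+ m %| p - a%:P}.
Proof.
elim: s => [|b s IHs] /=; first by exists 0.
case/andP=> bs /IHs[p sp].
pose q := \prod_(a <- s) ('X - a%:P) ^+ m.
have /Bezout_eq1_coprimepP[[u v] /= uv] : coprimep q (('X - b%:P) ^+ m).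
  rewrite /q; elim: (s) bs {sp IHs q} => [|a t IHt]; first by rewrite big_nil coprime1p.
  rewrite inE negb_or => /andP[ba bt]; rewrite big_cons coprimepMl IHt // andbT.
  by rewrite coprimep_expl // coprimep_expr // coprimep_XsubC root_XsubC.
(* [u * q] is 0 modulo the old factors and 1 modulo the new one. *)
exists (p + u * q * (b%:P - p)) => a; rewrite inE => /orP[/eqP->|as_].
  have -> : p + u * q * (b%:P - p) - b%:P = (p - b%:P) * v * ('X - b%:P) ^+ m.
    have -> : p + u * q * (b%:P - p) - b%:P = (p - b%:P) * (1 - u * q) by ring.
    by rewrite -uv addrAC subrr add0r mulrA.
  exact: dvdp_mull.
rewrite addrAC dvdp_add ?sp //; apply/dvdp_mulr/dvdp_mull.
by rewrite /q (big_rem a) //= dvdp_mulr.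
Qed.

(** Let [p] be congruent to [a] modulo a high power of ['X - a%:P] for each
    eigenvalue [a].  Then both the product of the [p - a%:P] and a power of
    ['X - p] are divisible by these high powers, hence by the characteristic
    polynomial: the former makes [p] of [X] diagonalizable, the latter makes
    the difference nilpotent. *)
Lemma jordan_poly_exists (F : closedFieldType) (n : nat) (X : 'M[F]_n.+1) :
  exists p, jordan_decomposition X (horner_mx X p) (X - horner_mx X p).
Proof.
have [r chiX] := closed_field_poly_normal (char_poly X).
rewrite (monicP (char_poly_monic X)) scale1r in chiX.
pose m := (size r).+1; pose s := undup r.
have [p sp] := simultaneous_congruence m (undup_uniq r).
(* A multiplicity in the characteristic polynomial is at most the exponent [m]. *)
have kill q : {in s, forall a, ('X - a%:P) ^+ m %| q} -> mxminpoly X %| q.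
  move=> sq; apply: dvdp_trans (mxminpoly_dvd_char X) _.
  rewrite chiX -prodr_undup_exp_count -/s.
  have: uniq s by apply: undup_uniq.
  elim: s sq => [|a t IHt] tq; first by rewrite big_nil dvd1p.
  move=> /= /andP[at_ ut]; rewrite big_cons Gauss_dvdp; last first.
    rewrite coprimep_expl //; elim: t at_ {IHt ut tq} => [|b t IHt].
      by rewrite big_nil coprimep1.
    rewrite inE negb_or => /andP[ab at_]; rewrite big_cons coprimepMr IHt // andbT.
    by rewrite coprimep_expr // coprimep_XsubC root_XsubC eq_sym.
  rewrite IHt // ?andbT => [|b bt]; last by apply: tq; rewrite inE bt orbT.
  apply: dvdp_trans (tq a (mem_head _ _)).
  by by rewrite dvdp_exp2l // /m leqW // count_size.
exists p; split.
- by rewrite addrC subrK.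
- apply/diagonalizableP; exists s; first exact: undup_uniq.
  apply: mxminpoly_min; apply/eqP.
  have -> : horner_mx (horner_mx X p) (\prod_(x <- s) ('X - x%:P)) =
            horner_mx X (\prod_(x <- s) (p - x%:P)).
    rewrite !rmorph_prod; apply: eq_bigr => a _.
    by rewrite !rmorphB /= horner_mx_X !horner_mx_C.
  rewrite -dvd_mxminpoly; apply: kill => a as_.
  by rewrite (big_rem a) //= dvdp_mulr // sp.
- exists m; apply/eqP.
  have -> : (X - horner_mx X p) ^+ m = horner_mx X (('X - p) ^+ m).
    by rewrite rmorphXn rmorphB /= horner_mx_X.
  rewrite -dvd_mxminpoly; apply: kill => a as_.
  apply: dvdp_exp2r.
  have -> : 'X - p = ('X - a%:P) - (p - a%:P) by rewrite opprB addrA subrK.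
  rewrite dvdp_sub //; apply: dvdp_trans (sp a as_); exact: dvdp_exp.
- apply: comm_mxB; last exact: comm_mx_refl.
  by apply: comm_horner_mx; exact: comm_mx_refl.
Qed.

Section JordanParts.
Variables (F : closedFieldType) (n : nat).
Implicit Types (X Y S N g : 'M[F]_n.+1).

(** Any other decomposition commutes with [X], hence with the polynomial one;
    the difference of the two semisimple parts is then both diagonalizable and
    nilpotent. *)
Lemma jordan_unique X : exists2 p : {poly F},
    jordan_decomposition X (horner_mx X p) (X - horner_mx X p)
  & forall S N, jordan_decomposition X S N ->
      S = horner_mx X p /\ N = X - horner_mx X p.
Proof.
have [p Xp] := jordan_poly_exists X; exists p => // S N [XSN dS nN SN].
have [_ dp np _] := Xp.
have pS : comm_mx (horner_mx X p) S.
  by apply: comm_horner_mx; rewrite /comm_mx XSN mulmxDl mulmxDr SN.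
have pN : comm_mx (horner_mx X p) N.
  by apply: comm_horner_mx; rewrite /comm_mx XSN mulmxDl mulmxDr SN.
have pX : comm_mx (horner_mx X p) X by apply: comm_horner_mx.
have SE : S = horner_mx X p.
  apply/eqP; rewrite -subr_eq0; apply/eqP/diagonalizable_nilpotent_eq0.
    have := diagonalizable_lincomb 1 (-1) (comm_mx_sym pS) dS dp.
    by rewrite scale1r scaleN1r.
  have -> : S - horner_mx X p = 1 *: (X - horner_mx X p) + (-1) *: N.
    by rewrite scale1r scaleN1r {2}XSN addrAC addrK addrC.
  apply: nilpotent_lincomb => //; apply: comm_mx_sym; apply: comm_mxB.
    by rewrite XSN; apply: comm_mxD => //; exact: comm_mx_sym.
  exact: comm_mx_sym.
by split=> //; rewrite -SE {1}XSN addrAC subrr add0r.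
Qed.

Lemma jordan_partsP X :
  jordan_decomposition X (semisimple_part X) (nilpotent_part X).
Proof.
have [p Xp _] := jordan_unique X.
have : [set q : _ * _ | jordan_decomposition X q.1 q.2]
    (horner_mx X p, X - horner_mx X p) by [].
exact: xgetI.
Qed.

Lemma jordan_parts_eq X S N : jordan_decomposition X S N ->
  semisimple_part X = S /\ nilpotent_part X = N.
Proof.
have [p _ Xp] := jordan_unique X.
by move=> /Xp[-> ->]; have /Xp := jordan_partsP X.
Qed.

Lemma jordan_parts_comm X Y : comm_mx X Y ->
  comm_mx (semisimple_part X) Y /\ comm_mx (nilpotent_part X) Y.
Proof.
have [p _ Xp] := jordan_unique X; have [-> ->] := Xp _ _ (jordan_partsP X).
move=> XY; have pY := comm_horner_mx p XY; split=> //.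
by apply/comm_mx_sym/comm_mxB; exact: comm_mx_sym.
Qed.

Lemma jordan_parts_lincomb a b X Y : comm_mx X Y ->
  jordan_decomposition (a *: X + b *: Y)
    (a *: semisimple_part X + b *: semisimple_part Y)
    (a *: nilpotent_part X + b *: nilpotent_part Y).
Proof.
move=> XY; have [XE dX nX cX] := jordan_partsP X.
have [YE dY nY cY] := jordan_partsP Y.
have [sXY nXY] := jordan_parts_comm XY.
have [sXs sXn] := jordan_parts_comm (comm_mx_sym sXY).
have [nXs nXn] := jordan_parts_comm (comm_mx_sym nXY).
split.
- by rewrite addrACA -!scalerDr -XE -YE.
- by apply: diagonalizable_lincomb => //; exact: comm_mx_sym.
- by apply: nilpotent_lincomb => //; exact: comm_mx_sym.
- rewrite !(mulmxDl, mulmxDr) -!scalemxAl -!scalemxAr cX cY nXs -sXn.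
  rewrite !scalerA [b * a]mulrC -!addrA; congr (_ + _).
  by rewrite !addrA; congr (_ + _); exact: addrC.
Qed.

End JordanParts.

(** * Rescaling the nilpotent part *)

Section Rescaling.
Variable F : fieldType.

Definition jordan_block k : 'M[F]_k := \matrix_(a, b) (a == b.+1 :> nat)%:R.

(** Matrices act on row vectors on the right.  A Jordan block in the image of
    the idempotent [E] is given by the inclusion [B] of its basis (as rows) and
    the projection [P] onto it, so that [P *m B] is an idempotent below [E] that
    commutes with [N] and with the diagonal matrix.

    With [k.+1] the nilpotency index of [N] on the image of [E], some entry
    [(i, j)] of [E *m N ^+ k] is nonzero.  The rows of [B] are the chain generated
    from the [i]-th basis vector, and the columns of [C] below are the chain
    generated from the [j]-th coordinate form.  Their pairing [T] is triangular
    with that nonzero entry all along the diagonal, hence invertible, which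
    makes the chain split off.  Starting from basis vectors makes the chains
    consist of eigenvectors of the diagonal matrix, and the nonzero entry forces
    the two eigenvalues to agree. *)
Lemma split_jordan_block n (d : 'rV[F]_n) (N E : 'M[F]_n) :
    nilpotent_mx N -> comm_mx N (diag_mx d) ->
    E *m E = E -> comm_mx E N -> comm_mx E (diag_mx d) -> E != 0 ->
  exists k s (P : 'M[F]_(n, k.+1)) (B : 'M[F]_(k.+1, n)),
    [/\ B *m P = 1%:M, E *m P = P /\ B *m E = B,
        B *m N = jordan_block _ *m B /\ N *m P = P *m jordan_block _
      & B *m diag_mx d = s *: B /\ diag_mx d *m P = s *: P].
Proof.
move=> nN Nd EE EN Ed E0.
have ENm m : E *m N ^+ m = N ^+ m *m E by apply: (commrX m EN).
have dNm m : diag_mx d *m N ^+ m = N ^+ m *m diag_mx d.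
  by apply: (commrX m (esym Nd)).
have [k ENk0 kmin] : exists2 k, E *m N ^+ k.+1 = 0 & E *m N ^+ k != 0.
  have exk : exists k, E *m N ^+ k == 0.
    by have [k Nk] := nN; exists k; rewrite Nk mulmx0.
  case: (ex_minnP exk) => -[|k] /eqP Ek mink.
    by move: E0; rewrite -Ek expr0 mulmx1 eqxx.
  by exists k => //; apply/negP => /mink; rewrite ltnn.
have NmN m : N ^+ m *m N = N ^+ m.+1 by rewrite exprSr.
have NNm m : N *m N ^+ m = N ^+ m.+1 by rewrite exprS.
have EN0 m : (k < m)%N -> E *m N ^+ m = 0.
  by move=> km; rewrite -(subnKC km) exprD -mulmxE mulmxA ENk0 mul0mx.
have /matrix0Pn[i [j Mij]] := kmin.
exists k, (d 0 i).
pose B : 'M[F]_(k.+1, n) := \matrix_(a, y) (E *m N ^+ (k - a)) i y.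
pose C : 'M[F]_(n, k.+1) := \matrix_(x, b) (E *m N ^+ b) x j.
have BZ m (Z : 'M_(n, m)) a y : (B *m Z) a y = (E *m N ^+ (k - a) *m Z) i y.
  by rewrite [LHS]mxE [RHS]mxE; apply: eq_bigr => x _; rewrite !mxE.
have ZC m (Z : 'M_(m, n)) x b : (Z *m C) x b = (Z *m (E *m N ^+ b)) x j.
  by rewrite [LHS]mxE [RHS]mxE; apply: eq_bigr => y _; rewrite !mxE.
pose T := B *m C.
have TE a b : T a b = (E *m N ^+ (k - a + b)) i j.
  by rewrite BZ ZC mulmxA -(mulmxA E) -ENm mulmxA EE -mulmxA mulmxE -exprD.
have Tu : T \in unitmx.
  rewrite unitmxE det_trig; last first.
    apply/is_trig_mxP => a b ab; rewrite TE EN0 ?mxE //.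
    by have := ltn_ord a; lia.
  rewrite unitfE; apply/prodf_neq0 => a _.
  by rewrite TE subnK // -ltnS.
have EC : E *m C = C by apply/matrixP => x b; rewrite ZC mulmxA EE [RHS]mxE.
have BE : B *m E = B.
  by apply/matrixP => a y; rewrite BZ -mulmxA -ENm mulmxA EE [RHS]mxE.
have BN : B *m N = jordan_block _ *m B.
  apply/matrixP => a y; rewrite BZ -mulmxA NmN.
  case: a => -[|a] ak.
    rewrite subn0 EN0 // !mxE big1 // => b _; by rewrite !mxE mul0r.
  rewrite [RHS]mxE (bigD1 (Ordinal (ltnW ak))) //= big1 => [|b ba].
    by rewrite !mxE eqxx mul1r addr0 -subSn // subSS.
  rewrite !mxE (_ : (_ == _) = false) ?mul0r //.
  by apply: contraNF ba => /eqP[ab]; apply/eqP/val_inj.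
have NC : N *m C = C *m jordan_block _.
  apply/matrixP => x b; rewrite ZC mulmxA -EN -mulmxA NNm [RHS]mxE.
  have [bk|kb] := ltnP b k.
    rewrite (bigD1 (Ordinal (bk : b.+1 < k.+1)%N)) //= big1 => [|a ab].
      by rewrite !mxE eqxx mulr1 addr0.
    by rewrite !mxE (_ : (_ == _) = false) ?mulr0 //; exact: negPf.
  rewrite EN0 ?ltnS // mxE big1 // => a _; rewrite !mxE.
  by rewrite (_ : (_ == _) = false) ?mulr0 //; have := ltn_ord a; lia.
have dij : d 0 i = d 0 j.
  have /matrixP/(_ i j) : diag_mx d *m (E *m N ^+ k) = E *m N ^+ k *m diag_mx d.
    by rewrite mulmxA -Ed -!mulmxA dNm.
  rewrite mul_diag_mx mul_mx_diag => dMd; apply: (mulfI Mij).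
  by move: dMd; rewrite [LHS]mxE [RHS]mxE mulrC.
have Bd : B *m diag_mx d = d 0 i *: B.
  apply/matrixP => a y; rewrite BZ -mulmxA -dNm mulmxA Ed -mulmxA.
  by rewrite mul_diag_mx [LHS]mxE [in RHS]mxE [in RHS]mxE.
have dC : diag_mx d *m C = d 0 i *: C.
  apply/matrixP => x b; rewrite ZC mulmxA -Ed -mulmxA dNm mulmxA.
  by rewrite mul_mx_diag !mxE mulrC dij.
have JT : jordan_block _ *m T = T *m jordan_block _.
  by rewrite mulmxA -BN -!mulmxA NC.
have TJ : invmx T *m jordan_block _ = jordan_block _ *m invmx T.
  by rewrite -[LHS](mulmxK Tu) -(mulmxA (invmx T)) JT mulKmx.
exists (C *m invmx T), B; split=> //.
- by rewrite mulmxA mulmxV.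
- by rewrite mulmxA EC.
- by rewrite mulmxA NC -!mulmxA TJ.
- by rewrite mulmxA dC scalemxAl.
Qed.

(** Conjugation by the powers of [c], written without dividing by [c]. *)
Lemma jordan_block_rescale k c :
  let D := diag_mx (\row_(a < k) c ^+ a) in
  D *m jordan_block k = c *: (jordan_block k *m D).
Proof.
rewrite /= mul_diag_mx mul_mx_diag; apply/matrixP => a b; rewrite !mxE.
by case: eqP => [->|_]; rewrite ?mulr0 ?mul0r ?mulr0 // mulr1 mul1r exprS.
Qed.

(** Induction on the rank of [E]: split one Jordan block [E1] off, rescale it by
    powers of [c], and treat the complementary idempotent [E - E1] by induction.
    Invertibility is stated inside the corner ring of [E], with unit [E], because
    the contributions of orthogonal idempotents can then simply be added. *)
Lemma corner_rescale n (d : 'rV[F]_n) (N E : 'M[F]_n) c : c != 0 ->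
    nilpotent_mx N -> comm_mx N (diag_mx d) ->
    E *m E = E -> comm_mx E N -> comm_mx E (diag_mx d) ->
  exists g h,
    [/\ g *m h = E /\ h *m g = E,
        [/\ E *m g = g, g *m E = g, E *m h = h & h *m E = h],
        g *m N = c *: (N *m g) & comm_mx g (diag_mx d)].
Proof.
move=> c0 nN Nd.
have [r] := ubnP (\rank E); elim: r => // r IHr in E *; rewrite ltnS.
move=> rkE EE EN Ed.
have [E0|E0] := eqVneq E 0.
  exists 0, 0; rewrite E0 !mul0mx !mulmx0 scaler0; split=> //.
  by rewrite /comm_mx mul0mx mulmx0.
have [k [s [P [B [BP [EP BE] [BN NP] [Bd dP]]]]]] :=
  split_jordan_block nN Nd EE EN Ed E0.
pose E1 := P *m B; pose E2 := E - E1.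
have EE1 : E *m E1 = E1 by rewrite mulmxA EP.
have E1E : E1 *m E = E1 by rewrite -mulmxA BE.
have E11 : E1 *m E1 = E1 by rewrite mulmxA -(mulmxA P) BP mulmx1.
have E1N : comm_mx E1 N by rewrite /comm_mx /E1 -mulmxA BN !mulmxA NP.
have E1d : comm_mx E1 (diag_mx d).
  by rewrite /comm_mx /E1 -mulmxA Bd mulmxA dP -scalemxAr -scalemxAl.
have E12 : E1 *m E2 = 0 by rewrite mulmxBr E1E E11 subrr.
have E21 : E2 *m E1 = 0 by rewrite mulmxBl EE1 E11 subrr.
have EE2 : E *m E2 = E2 by rewrite mulmxBr EE EE1.
have E2E : E2 *m E = E2 by rewrite mulmxBl EE E1E.
have E22 : E2 *m E2 = E2 by rewrite {1}/E2 mulmxBl EE2 E12 subr0.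
have E10 : E1 != 0.
  apply/eqP => /(congr1 (fun Z => B *m Z *m P)).
  rewrite mulmxA BP mul1mx BP mulmx0 mul0mx => /matrixP/(_ 0 0)/eqP.
  by rewrite !mxE oner_eq0.
have rk2 : (\rank E2 < r)%N.
  apply: leq_trans rkE; suff: (E2 < E)%MS by rewrite ltmxErank => /andP[].
  rewrite ltmxE -{1}E2E submxMl /=; apply: contra E10 => /submxP[Z EZ].
  by rewrite -EE1 EZ -mulmxA E21 mulmx0.
have E2N : comm_mx E2 N by apply/comm_mx_sym/comm_mxB; exact: comm_mx_sym.
have E2d : comm_mx E2 (diag_mx d).
  by apply/comm_mx_sym/comm_mxB; exact: comm_mx_sym.
have [g [h [[gh hg] [Eg gE Eh hE] gN gd]]] := IHr _ rk2 E22 E2N E2d.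
pose D := diag_mx (\row_(a < k.+1) c ^+ a).
pose D' := diag_mx (\row_(a < k.+1) c ^- a).
have DD' : D *m D' = 1%:M.
  rewrite mulmx_diag -diag_const_mx; congr diag_mx; apply/rowP => a.
  by rewrite !mxE mulfV // expf_neq0.
have D'D : D' *m D = 1%:M by rewrite -(diag_mx_comm _ _ : D *m D' = _).
pose g1 := P *m D *m B; pose h1 := P *m D' *m B.
have PXB (X Y : 'M_k.+1) : P *m X *m B *m (P *m Y *m B) = P *m (X *m Y) *m B.
  by rewrite !mulmxA -(mulmxA _ B P) BP mulmx1.
have E1X (X : 'M_k.+1) : E1 *m (P *m X *m B) = P *m X *m B.
  by rewrite !mulmxA -(mulmxA P B P) BP mulmx1.
have XE1 (X : 'M_k.+1) : P *m X *m B *m E1 = P *m X *m B.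
  by rewrite !mulmxA -(mulmxA _ B P) BP mulmx1.
have EX (X : 'M_k.+1) : E *m (P *m X *m B) = P *m X *m B.
  by rewrite !mulmxA EP.
have XE (X : 'M_k.+1) : P *m X *m B *m E = P *m X *m B.
  by rewrite -mulmxA BE.
have XY0 (X : 'M_k.+1) Y : E2 *m Y = Y -> P *m X *m B *m Y = 0.
  by move=> <-; rewrite -XE1 -mulmxA (mulmxA E1) E12 mul0mx mulmx0.
have YX0 (X : 'M_k.+1) Y : Y *m E2 = Y -> Y *m (P *m X *m B) = 0.
  by move=> <-; rewrite -E1X -mulmxA (mulmxA E2) E21 mul0mx mulmx0.
have EY Y : E2 *m Y = Y -> E *m Y = Y by move=> <-; rewrite mulmxA EE2.
have YE Y : Y *m E2 = Y -> Y *m E = Y by move=> <-; rewrite -mulmxA E2E.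
exists (g1 + g), (h1 + h); split.
- split.
  + rewrite mulmxDl !mulmxDr PXB XY0 // YX0 // DD' mulmx1 addr0 add0r gh.
    by rewrite addrC subrK.
  + rewrite mulmxDl !mulmxDr PXB XY0 // YX0 // D'D mulmx1 addr0 add0r hg.
    by rewrite addrC subrK.
- by split; rewrite ?mulmxDr ?mulmxDl ?EX ?XE ?EY ?YE.
- rewrite mulmxDl mulmxDr scalerDr gN; congr (_ + _).
  rewrite -mulmxA BN mulmxA -(mulmxA P) jordan_block_rescale.
  by rewrite -scalemxAr -scalemxAl !mulmxA NP.
- apply/comm_mx_sym/comm_mxD; last exact: comm_mx_sym.
  by rewrite /comm_mx !mulmxA dP -!mulmxA Bd -!scalemxAr -!scalemxAl.
Qed.

Lemma rescale_nilpotent_part n (X S N : 'M[F]_n) c :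
  jordan_decomposition X S N -> c != 0 ->
  exists2 g, g \in unitmx & g *m X *m invmx g = S + c *: N.
Proof.
move=> [-> /diagonalizable_eigenbasis[P [d [Pu PS]]] nN SN] c0.
have PSP : diag_mx d = P *m S *m invmx P by rewrite PS mulmxK.
pose N1 := P *m N *m invmx P.
have N1d : comm_mx N1 (diag_mx d).
  by rewrite /comm_mx /N1 PSP !mulmxA !mulmxKV // -!(mulmxA P) SN.
have [||g [h [[gh hg] _ gN gd]]] :=
    corner_rescale c0 (nilpotent_conj Pu nN) N1d (mul1mx 1%:M).
- by rewrite /comm_mx mul1mx mulmx1.
- by rewrite /comm_mx mul1mx mulmx1.
have [gu _] := mulmx1_unit gh.
exists (invmx P *m g *m P); first by rewrite !unitmx_mul unitmx_inv Pu gu.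
apply: (canLR (mulmxK _)); first by rewrite !unitmx_mul unitmx_inv Pu gu.
have PSZ a : P *m (S + a *: N) = (diag_mx d + a *: N1) *m P.
  by rewrite mulmxDr mulmxDl PS -scalemxAr -scalemxAl mulmxKV.
apply: (can_inj (mulKmx Pu)); rewrite !mulmxA mulmxV // mul1mx.
rewrite -(mulmxA g) -{1}(scale1r N) !PSZ mulmxK // scale1r mulmxA.
by congr (_ *m P); rewrite mulmxDr mulmxDl gN gd scalemxAl.
Qed.
End Rescaling.

(** * Admissible sets *)

Section Admissible.
Variables (F : fieldType) (n : nat).
Implicit Types (X Y g : 'M[F]_n) (M : set 'M[F]_n).

Lemma admissibleP M : admissible M <->
  [/\ M 0,
      forall g X, g \in unitmx -> M X -> M (g *m X *m invmx g)
    & forall a b X Y, comm_mx X Y -> M X -> M Y -> M (a *: X + b *: Y)].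
Proof.
split=> [[M0 MJ Mspan]|[M0 MJ Mlin]]; split=> //.
- by move=> g X gu MX; rewrite -(MJ g gu); exists X.
- move=> a b X Y XY MX MY; apply: (Mspan X Y) => //=.
  by rewrite rpredD // rpredZ // memv_span // !inE eqxx ?orbT.
- move=> g gu; apply/seteqP; split=> [_ [X MX <-]|X MX]; first exact: MJ.
  exists (invmx g *m X *m g); last by rewrite !mulmxA mulmxV // mul1mx mulmxK.
  by rewrite -{2}[g]invmxK; apply: MJ; rewrite ?unitmx_inv.
- move=> X Y MX MY XY Z /=; rewrite span_cons span_seq1.
  by case/memv_addP=> _ /vlineP[a ->] [_ /vlineP[b ->] ->]; apply: Mlin.
Qed.

Lemma admissibleI M M' : admissible M -> admissible M' -> admissible (M `&` M').
Proof.
move=> /admissibleP[M0 MJ Ml] /admissibleP[M'0 M'J M'l]; apply/admissibleP.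
split=> [//|g X gu [MX M'X]|a b X Y XY [MX M'X] [MY M'Y]].
  by split; [exact: MJ | exact: M'J].
by split; [exact: Ml | exact: M'l].
Qed.

Lemma diagonalizable_admissible : admissible (@diagonalizable_set F n).
Proof.
apply/admissibleP; split=> [|g X|a b X Y].
- exact: diagonalizable0.
- exact: diagonalizable_conj.
- exact: diagonalizable_lincomb.
Qed.

Lemma nilpotent_admissible : admissible (@nilpotent_set F n).
Proof.
apply/admissibleP; split=> [|g X|a b X Y].
- exact: nilpotent0.
- exact: nilpotent_conj.
- exact: nilpotent_lincomb.
Qed.

End Admissible.

Section SplitJoin.
Variables (F : closedFieldType) (n : nat).
Implicit Types (X Y S N g : 'M[F]_n.+1) (M : set 'M[F]_n.+1).

Lemma exists_neq0_neq1 : exists2 c : F, c != 0 & c != 1.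
Proof.
have /closed_nonrootP[c] : ('X * ('X - 1%:P) : {poly F}) != 0.
  by rewrite mulf_neq0 ?polyX_eq0 ?polyXsubC_eq0.
by rewrite rootM rootX root_XsubC negb_or => /andP[]; exists c.
Qed.

(** The nontrivial direction uses that [X] is similar to [S + c *: N], which
    commutes with [X]; the difference is a nonzero multiple of [N] if [c != 1]. *)
Lemma admissible_jordan_parts M X S N :
  admissible M -> jordan_decomposition X S N -> M X <-> M S /\ M N.
Proof.
move=> /admissibleP[M0 MJ Ml] XSN; have [XE _ _ SN] := XSN.
split=> [MX|[MS MN]]; last first.
  by have := Ml 1 1 S N SN MS MN; rewrite !scale1r -XE.
have [c c0 c1] := exists_neq0_neq1.
have [g gu gX] := rescale_nilpotent_part XSN c0.
have MY : M (S + c *: N) by rewrite -gX; apply: MJ.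
have XY : comm_mx X (S + c *: N).
  rewrite XE /comm_mx !(mulmxDl, mulmxDr) -!scalemxAl -!scalemxAr SN.
  by rewrite !addrA; congr (_ + _); rewrite -!addrA; congr (_ + _); exact: addrC.
have MN : M N.
  have := Ml (c - 1)^-1 (- (c - 1)^-1) _ _ (comm_mx_sym XY) MY MX.
  rewrite scaleNr -scalerBr XE opprD addrACA subrr add0r.
  rewrite -{2}[N]scale1r -scalerBl scalerA mulVf ?subr_eq0 //.
  by rewrite scale1r.
split=> //; have XN : comm_mx X N by rewrite XE /comm_mx mulmxDl mulmxDr SN.
have := Ml 1 (-1) _ _ XN MX MN.
by rewrite scale1r scaleN1r XE addrK.
Qed.

Lemma split_admissible_family M : admissible M ->
  (admissible_ss_family F n.+1 `*` admissible_nil_family F n.+1)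
    (split_admissible M).
Proof.
move=> adM; split; split; try exact: subIsetr.
  exact/admissibleI/diagonalizable_admissible.
exact/admissibleI/nilpotent_admissible.
Qed.

(** The parts of commuting matrices commute, so the span condition may be applied
    to the semisimple and nilpotent parts separately. *)
Lemma join_admissible_family M M' : admissible M -> admissible M' ->
  admissible (join_admissible (M, M')).
Proof.
move=> /admissibleP[M0 MJ Ml] /admissibleP[M'0 M'J M'l]; apply/admissibleP.
split=> [|g X gu [MX M'X]|a b X Y XY [MX M'X] [MY M'Y]]; rewrite /join_admissible /=.
- have [|-> ->] := @jordan_parts_eq F n 0 0 0; last by [].
  by split; rewrite ?addr0 //; [exact: diagonalizable0 | exact: nilpotent0].
- have [-> ->] := jordan_parts_eq (jordan_conj gu (jordan_partsP X)).
  by split; [exact: MJ | exact: M'J].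
- have [-> ->] := jordan_parts_eq (jordan_parts_lincomb a b XY).
  have [sXY nXY] := jordan_parts_comm XY.
  have [sXs sXn] := jordan_parts_comm (comm_mx_sym sXY).
  have [nXs nXn] := jordan_parts_comm (comm_mx_sym nXY).
  by split; [apply: Ml | apply: M'l] => //; exact: comm_mx_sym.
Qed.

Lemma split_admissibleK M :
  admissible M -> join_admissible (split_admissible M) = M.
Proof.
move=> adM; apply/seteqP; split=> X; have [_ sX nX _] := jordan_partsP X.
  by move=> [[MS _] [MN _]]; apply/(admissible_jordan_parts adM (jordan_partsP X)).
by move=> /(admissible_jordan_parts adM (jordan_partsP X))[MS MN].
Qed.

Lemma join_admissibleK M M' :
    M 0 -> M' 0 -> M `<=` @diagonalizable_set F n.+1 ->
    M' `<=` @nilpotent_set F n.+1 ->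
  split_admissible (join_admissible (M, M')) = (M, M').
Proof.
move=> M0 M'0 Md M'n.
have ss X : diagonalizable X -> semisimple_part X = X /\ nilpotent_part X = 0.
  move=> dX; apply: jordan_parts_eq.
  by split; rewrite ?addr0 ?mulmx0 ?mul0mx //; exact: nilpotent0.
have nil X : nilpotent_mx X -> semisimple_part X = 0 /\ nilpotent_part X = X.
  move=> nX; apply: jordan_parts_eq.
  by split; rewrite ?add0r ?mulmx0 ?mul0mx //; exact: diagonalizable0.
congr (_, _); apply/seteqP; split=> X; rewrite /join_admissible /=.
- by move=> [[MX _] /ss[<- _]].
- by move=> MX; have dX := Md _ MX; have [-> ->] := ss X dX.
- by move=> [[_ MX] /nil[_ <-]].
- by move=> MX; have nX := M'n _ MX; have [-> ->] := nil X nX.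
Qed.

End SplitJoin.

(** * The bijection *)

Lemma cancel_set_bij (aT rT : Type) (A : set aT) (B : set rT)
    (f : aT -> rT) (g : rT -> aT) :
    set_fun A B f -> set_fun B A g ->
    {in A, cancel f g} -> {in B, cancel g f} ->
  set_bij A B f.
Proof.
move=> fAB gBA fK gK; split=> //; first exact: can_in_inj fK.
by move=> y By; exists (g y); [exact: gBA | rewrite gK ?inE].
Qed.

Theorem theorem1p1 (F : closedFieldType) (n : nat) (n_gt0 : (0 < n)%N) :
  [/\ set_bij (admissible_family F n)
        (admissible_ss_family F n `*` admissible_nil_family F n)
        (@split_admissible F n),
      set_bij (admissible_ss_family F n `*` admissible_nil_family F n)
        (admissible_family F n)
        (@join_admissible F n),
      {in admissible_family F n,
        cancel (@split_admissible F n) (@join_admissible F n)}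
    & {in admissible_ss_family F n `*` admissible_nil_family F n,
        cancel (@join_admissible F n) (@split_admissible F n)}].
Proof.
case: n n_gt0 => // n _.
have splitF := @split_admissible_family F n.
have joinF p : (admissible_ss_family F n.+1 `*` admissible_nil_family F n.+1) p ->
    admissible (join_admissible p).
  by case: p => M M' [[adM _] [adM' _]]; apply: join_admissible_family.
have splitK : {in admissible_family F n.+1,
    cancel (@split_admissible F n.+1) (@join_admissible F n.+1)}.
  by move=> M; rewrite inE => adM; apply: split_admissibleK.
have joinK : {in admissible_ss_family F n.+1 `*` admissible_nil_family F n.+1,
    cancel (@join_admissible F n.+1) (@split_admissible F n.+1)}.
  move=> [M M']; rewrite inE => -[[[M0 _ _] Md] [[M'0 _ _] M'n]].
  exact: join_admissibleK.
split=> //; first exact: cancel_set_bij splitK joinK.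
exact: cancel_set_bij joinK splitK.
Qed.
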